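(* Let $f$ be a random multiplicative function in the sense of Wintner and let $\varepsilon>0$. There exists a positive constant $C_\varepsilon$ such that, almost surely, for all $x,y\geq 2$ with $y\geq C_\varepsilon\log x$, $$\Psi_f(x,y)\ll \Psi^*(x,y)^{1/2+\varepsilon}.$$
   Context: Random multiplicative function in the sense of Wintner: let $\{f(p)\}_{p\text{ prime}}$ be a sequence of independent random variables, each taking the values $+1$ and $-1$ with probability $1/2$; for $n\geq 1$ put $f(n):=\mu(n)^2\prod_{p\mid n}f(p)$, where $\mu$ is the Möbius function. $P^+(n)$ denotes the largest prime factor of $n$, with $P^+(1):=1$. $S(x,y)$ is the set of positive integers $n\leq x$ with $P^+(n)\leq y$. For an arithmetic function $g$, $\Psi_g(x,y):=\sum_{n\in S(x,y)}g(n)$. $\Psi^*(x,y):=\Psi_{\mu^2}(x,y)$ is the number of squarefree elements of $S(x,y)$. Here $x,y$ are real. $A\ll B$ means $|A|\leq CB$ for some constant $C>0$, uniformly for all $x,y$ in the indicated range. In an almost sure statement, the constant $C$ may depend on the realization of $f$ (and on $\varepsilon$), but not on $x,y$. *)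

(* Defs.v *)
From HB Require Import structures.
From mathcomp Require Import all_boot all_order all_algebra.
From mathcomp Require Import finmap.
From mathcomp Require Import all_classical all_reals all_analysis.

Set Implicit Arguments.
Unset Strict Implicit.
Unset Printing Implicit Defensive.

Import Order.TTheory GRing.Theory Num.Theory.
Import numFieldNormedType.Exports.

Local Open Scope classical_set_scope.
Local Open Scope ring_scope.

(* Meaningful for n >= 1; at n = 0 it is set to 0. *)
Definition moebius (n : nat) : int :=
  if (0 < n)%N && all (fun p => logn p n == 1)%N (primes n)
  then (-1) ^+ size (primes n) else 0.

(* The elements of S(x, y); the library's max_pdiv satisfies max_pdiv 1 = 1,
   which is the convention P^+(1) = 1. *)
Definition smooth_set (R : realType) (x y : R) : set nat :=
  [set n | [/\ (0 < n)%N, n%:R <= x & (max_pdiv n)%:R <= y]].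

(* The sum below over smooth_set is a finitely supported sum, which the library
   sets to 0 on an infinite support: this lemma rules that case out. *)
Lemma finite_smooth_set (R : realType) (x y : R) : finite_set (smooth_set x y).
Proof.
apply: (@sub_finite_set _ _ `I_(Num.truncn x).+1); last exact: finite_II.
move=> n [_ nx _] /=; rewrite ltnS.
have x0 : 0 <= x by apply: le_trans nx; rewrite ler0n.
by rewrite truncn_ge_nat.
Qed.

Definition Psi (R : realType) (g : nat -> R) (x y : R) : R :=
  \sum_(n \in smooth_set x y) g n.

Definition Psi_star (R : realType) (x y : R) : R :=
  Psi (fun n => (moebius n ^+ 2)%:~R) x y.

(* Mutual independence of the family (X i), i in D: the product rule holds for
   every finite subfamily and all Borel sets. *)
Definition mutually_independent d (T : measurableType d) (R : realType)
    (P : probability T R) (I : choiceType) (D : set I)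
    (X : I -> {RV P >-> R}) : Prop :=
  forall (J : {fset I}) (B : I -> set R),
    (forall i, i \in J -> D i) ->
    (forall i, i \in J -> measurable (B i)) ->
    P (\bigcap_(i in [set` J]) (X i @^-1` B i)) =
    (\prod_(i <- J) P (X i @^-1` B i))%E.

(* Only the values of X at primes matter. *)
Definition prime_signs d (T : measurableType d) (R : realType)
    (P : probability T R) (X : nat -> {RV P >-> R}) : Prop :=
  mutually_independent [set p | prime p] X /\
  forall p, prime p ->
    P (X p @^-1` [set 1]) = (2^-1)%:E /\ P (X p @^-1` [set -1]) = (2^-1)%:E.

(* The realization at w of the random multiplicative function built on X. *)
Definition wintner d (T : measurableType d) (R : realType)
    (P : probability T R) (X : nat -> {RV P >-> R}) (w : T) (n : nat) : R :=
  (moebius n ^+ 2)%:~R * \prod_(p <- primes n) X p w.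

(* Main.v *)
Require Import Defs.
From HB Require Import structures.
From mathcomp Require Import all_boot all_order all_algebra.
From mathcomp Require Import finmap.
From mathcomp Require Import all_classical all_reals all_analysis.
From mathcomp Require Import zify ring lra.

(** Fix [y] and write a squarefree [y]-smooth integer as the set [A] of its prime
factors; [f] becomes the product of the signs over [A], and [Psi_f (x, y)] a
Rademacher chaos indexed by the finite family of those sets whose product is at
most [x].  The argument has three ingredients.

Moments.  A polynomial in independent signs with coefficients 0 and 1 is
hypercontractive ([chaos_moment]): its [2k]-th moment is at most the [k]-th
power of the sum of [(4k+1)^omega(n)] over the integers [n] involved.

Weights.  Let [B] be any constant.  If [y >= C log x] with [C] large in terms of
[B], every squarefree [y]-smooth [n <= x] satisfies
[B^omega(n) << Psi* (x, y)] ([expn_card_le_fam]).  With [y^t <= x < y^(t+1)],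
the products of [t] primes give [Psi* >= binomial(pi(y), t)], and Chebyshev's
lower bound for [pi] gives [D t <= pi(y)] with [D] as large as desired
([trunc_log_le_primes]), so that [Psi* >= D^t].  This settles the integers
with [omega(n) <= 9t]; if [R = omega(n) > 9t], then [R! <= x < y^(2t)] forces
[t^4 < y], the binomial is at least [y^(t/4)] for large [y], and [B^R] is absorbed by [R!].
Taking [B = (4k+1)^k] gives [E Psi_f^(2k) << Psi*^(k+1)].

Union bound.  For fixed [y] the sum [Psi_f (x, y)] depends only on the number
[j = Psi* (x, y)] of its terms, because the families are nested in [x]
([fam_eq]).  For each pair ([y], [j]) Markov's inequality with [2 k eps >= 5]
bounds the probability of [|Psi_f| > j^(1/2+eps)] by [O (j^-4)]
([large_patterns_le]).  Since [j >= pi(y)], only [O (j^2)] integers [y] occur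
with a given [j], so the probabilities are summable over [j] and the
Borel-Cantelli lemma concludes.  The range [y > x] reduces to [y = x]. *)

Set Implicit Arguments.
Unset Strict Implicit.
Unset Printing Implicit Defensive.

Import Order.TTheory GRing.Theory Num.Theory.

(** * A lower bound for the number of primes *)

Local Open Scope nat_scope.

(** The finite type of primes [p <= m]; its cardinal is [pi(m)], and [pval]
sends such a prime to its value. *)
Definition prime_le (m : nat) : finType := {p : 'I_m.+1 | prime p}.

Definition pval (m : nat) (p : prime_le m) : nat := val (val p).

Lemma pval_prime m (p : prime_le m) : prime (pval p).
Proof. exact: (valP p). Qed.

Lemma pval_le m (p : prime_le m) : pval p <= m.
Proof. by rewrite -ltnS; exact: ltn_ord. Qed.

Lemma pval_inj m : injective (@pval m).
Proof. by move=> p q /ord_inj/val_inj. Qed.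

Lemma pvalP m k : prime k -> k <= m -> exists p : prime_le m, pval p = k.
Proof.
move=> kP; rewrite -ltnS => km.
by exists (exist (fun p : 'I_m.+1 => prime p) (Ordinal km) kP).
Qed.

Lemma size_le_prime_le m (s : seq nat) : uniq s ->
  {in s, forall p, prime p && (p <= m)} -> size s <= #|prime_le m|.
Proof.
move=> us sm; rewrite cardE -(size_map (@pval m) (enum _)).
apply: uniq_leq_size => // p /sm/andP[pP pm].
have [q <-] := pvalP pP pm.
by apply: map_f; rewrite mem_enum.
Qed.

Lemma card_prime_le_mono m n : m <= n -> #|prime_le m| <= #|prime_le n|.
Proof.
move=> mn; rewrite cardE -(size_map (@pval m) (enum _)).
apply: size_le_prime_le; first by rewrite map_inj_uniq ?enum_uniq//; exact: pval_inj.
move=> _ /mapP[p _ ->]; rewrite pval_prime /=.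
exact: leq_trans (pval_le p) mn.
Qed.

(** Each prime power dividing the central binomial coefficient is at most [2n]:
in Legendre's formula the difference [2n %/ p^k - 2 (n %/ p^k)] is 0 or 1, and
it vanishes once [p^k > 2n]. *)
Lemma exp_logn_bin_le p n : prime p -> 0 < n ->
  p ^ logn p 'C(n.*2, n) <= n.*2.
Proof.
move=> pP n0.
have p1 := prime_gt1 pP.
set L := trunc_log p n.*2.
have n20 : 0 < n.*2 by rewrite double_gt0.
suff logL : logn p 'C(n.*2, n) <= L.
  apply: leq_trans (trunc_logP p1 n20).
  by rewrite leq_exp2l.
have nn : n <= n.*2 by rewrite -addnn leq_addr.
have binE := bin_fact nn.
have {}binE : logn p 'C(n.*2, n) + (logn p n`!).*2 = logn p (n.*2)`!.
  rewrite -binE (_ : n.*2 - n = n); last by lia.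
  by rewrite !lognM ?muln_gt0 ?fact_gt0 ?bin_gt0// addnn.
have factE : logn p n`! = \sum_(1 <= k < n.*2.+1) n %/ p ^ k.
  rewrite logn_fact// [RHS](big_cat_nat _ (n := n.+1))//= [X in _ + X]big_nat_cond.
  rewrite [X in _ + X]big1 ?addn0// => k /andP[/andP[nk _] _].
  by apply: divn_small; apply: ltn_trans (ltn_expl k p1).
rewrite -(leq_add2r (logn p n`!).*2) binE logn_fact// factE.
have sumL : \sum_(1 <= k < n.*2.+1) (k <= L) <= L.
  apply: (@leq_trans (\sum_(1 <= k < L.+1) 1)); last by rewrite sum_nat_const_nat; lia.
  have [LN|NL] := leqP L n.*2; last first.
    apply: (@leq_trans (\sum_(1 <= k < n.*2.+1) 1)).
      by apply: leq_sum => k _; exact: leq_b1.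
    by rewrite !sum_nat_const_nat; lia.
  rewrite (big_cat_nat _ (n := L.+1))//= [X in _ + X]big_nat_cond.
  rewrite [X in _ + X]big1 ?addn0 => [|k /andP[/andP[Lk _] _]].
    by apply: leq_sum => k _; exact: leq_b1.
  by rewrite leqNgt Lk.
apply: (@leq_trans (\sum_(1 <= k < n.*2.+1) ((k <= L) + (n %/ p ^ k).*2))); last first.
  rewrite big_split /= leq_add//.
  by rewrite -[leqRHS]mul2n big_distrr /=; apply: leq_sum => k _; rewrite mul2n.
apply: leq_sum => k _.
have [kL|Lk] := leqP k L.
  have pk0 : 0 < p ^ k by rewrite expn_gt0 (ltn_trans _ p1).
  rewrite -ltnS ltn_divLR//.
  by have := ltn_ceil n pk0; lia.
rewrite divn_small//.
apply: leq_trans (trunc_log_ltn n.*2 p1) _.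
by rewrite leq_exp2l.
Qed.

Lemma expn2_le_bin n : 2 ^ n <= 'C(n.*2, n).
Proof.
elim: n => [//|n IH].
rewrite doubleS binS expnS mul2n -addnn leq_add//.
  by rewrite binS (leq_trans IH)// leq_addl.
have -> : 'C(n.*2.+1, n) = 'C(n.*2.+1, n.+1).
  rewrite -bin_sub; last by lia.
  by congr 'C(_, _); lia.
by rewrite binS (leq_trans IH)// leq_addl.
Qed.

Lemma bin_le_card_primes n : 0 < n ->
  'C(n.*2, n) <= n.*2 ^ #|prime_le n.*2|.
Proof.
move=> n0.
have b0 : 0 < 'C(n.*2, n) by rewrite bin_gt0; lia.
rewrite {1}(prod_prime_decomp b0) prime_decompE big_map /=.
apply: (@leq_trans (n.*2 ^ size (primes 'C(n.*2, n)))).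
  rewrite -[X in _ ^ X]count_predT -iter_muln_1 -big_const_seq big_seq [leqRHS]big_seq.
  apply: leq_prod => p; rewrite mem_primes => /andP[pP _].
  exact: exp_logn_bin_le.
rewrite leq_pexp2l// ?double_gt0//.
apply: size_le_prime_le; first exact: primes_uniq.
move=> p; rewrite mem_primes => /and3P[pP _ pC]; rewrite pP /=.
have : p <= n.*2.
  have plog : 0 < logn p 'C(n.*2, n) by rewrite -pfactor_dvdn.
  apply: leq_trans (exp_logn_bin_le pP n0).
  by rewrite -{1}(expn1 p) leq_pexp2l// prime_gt0.
by [].
Qed.

Lemma leq_exp2r_w a b e : a <= b -> a ^ e <= b ^ e.
Proof. by case: e => [//|e ab]; rewrite leq_exp2r. Qed.

(** Chebyshev's lower bound, in the form [m log 2 <= 3 pi(m) log m]. *)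
Lemma card_primes_lower m : 1 < m -> 2 ^ m <= m ^ (3 * #|prime_le m|).
Proof.
move=> m1.
have n0 : 0 < m./2 by lia.
have h2 := leq_trans (expn2_le_bin _) (bin_le_card_primes n0).
apply: (@leq_trans ((2 ^ m./2) ^ 3)).
  by rewrite -expnM leq_exp2l//; lia.
rewrite mulnC expnM leq_exp2r//.
apply: leq_trans h2 _.
apply: (@leq_trans (m ^ #|prime_le m./2.*2|)).
  by apply: leq_exp2r_w; lia.
rewrite leq_exp2l//; apply: card_prime_le_mono; lia.
Qed.

Lemma eventually_expn6_lt : exists c, forall s, c <= s -> s.+1 ^ 6 < 2 ^ s.
Proof.
(* The constant is abstracted so that its unary value is never computed. *)
have [c cE] : exists c, c = 7 ^ 6 by exists (7 ^ 6).
exists (7 * c) => s cs.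
have qs : 7 * (s %/ 7) <= s by rewrite mulnC leq_divM.
have cq : c <= s %/ 7 by rewrite leq_divRL// mulnC.
have sq : s.+1 <= 7 * (s %/ 7).+1 by have := ltn_ceil s (isT : 0 < 7); lia.
apply: (@leq_trans ((s %/ 7).+1 ^ 7)).
  apply: (@leq_ltn_trans (c * (s %/ 7).+1 ^ 6)).
    by rewrite cE -expnMn leq_exp2r.
  by rewrite (expnS _ 6) ltn_pmul2r ?expn_gt0.
apply: leq_trans (leq_pexp2l _ qs) => //.
by rewrite mulnC expnM; apply: leq_exp2r_w; exact: ltn_expl.
Qed.

(** If [pi(m) <= s] with [s^2 <= m < (s+1)^2], Chebyshev's bound gives [2^(s^2) <= m^(3s)],
hence [2^s <= m^3 < (s+1)^6], which fails for large [s]. *)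
Lemma card_primes_sq : exists m0, forall m, m0 <= m -> m <= #|prime_le m| ^ 2.
Proof.
have [c hc] := eventually_expn6_lt.
exists (c ^ 2).+2 => m cm; rewrite leqNgt; apply/negP => pim.
have [s /andP[s1 s2]] : exists s, s ^ 2 <= m < s.+1 ^ 2.
  elim: m {cm pim} => [|m [s /andP[s1 s2]]]; first by exists 0.
  have [h|h] := ltnP m.+1 (s.+1 ^ 2).
    by exists s; rewrite h andbT (leq_trans s1).
  exists s.+1; rewrite h /=; apply: leq_ltn_trans s2 _.
  by rewrite ltn_exp2r.
have cs : c <= s.
  rewrite -ltnS -(ltn_exp2r _ _ (isT : 0 < 2)).
  by apply: leq_ltn_trans s2; lia.
have m1 : 1 < m by apply: leq_trans cm.
have pis : #|prime_le m| <= s.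
  by rewrite -ltnS -(ltn_exp2r _ _ (isT : 0 < 2)) (ltn_trans pim).
have s0 : 0 < s by case: s s1 s2 {cs pis}  => // _; rewrite exp1n; lia.
have := hc s cs; apply/negP; rewrite -leqNgt.
rewrite -(leq_exp2r _ _ s0) -expnM -[in X in _ <= X]expnM.
apply: (@leq_trans (2 ^ m)); first by rewrite leq_pexp2l.
apply: leq_trans (card_primes_lower m1) _.
apply: (@leq_trans (m ^ (3 * s))); first by rewrite leq_pexp2l ?leq_mul//; lia.
rewrite (_ : 6 * s = 2 * (3 * s)); last by lia.
by rewrite [leqRHS]expnM; apply: leq_exp2r_w; exact: ltnW.
Qed.

(** * Squarefree smooth integers and the size of [omega] *)

(** The squarefree integers [n <= N] all of whose prime factors are at most [m],
each encoded by the set of its prime factors. *)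
Definition smooth_fam (N m : nat) : {set {set prime_le m}} :=
  [set A : {set prime_le m} | \prod_(p in A) pval p <= N].

Lemma bin_le_card_fam N m t : m ^ t <= N -> 'C(#|prime_le m|, t) <= #|smooth_fam N m|.
Proof.
move=> mtN; rewrite -card_draws; apply: subset_leq_card.
apply/fintype.subsetP => A; rewrite !inE => /eqP At; apply: leq_trans mtN.
rewrite -At -prod_nat_const; apply: leq_prod => p _; exact: pval_le.
Qed.

Lemma fact_le_prod (I : finType) (f : I -> nat) (A : {set I}) :
  injective f -> (forall i, 0 < f i) -> (#|A|)`! <= \prod_(i in A) f i.
Proof.
move=> finj f0; move En : #|A| => n.
elim: n A En => [|n IH] A An; first by rewrite fact0 prodn_gt0.
have [a aA] : exists a, a \in A by apply/set0Pn; rewrite -card_gt0 An.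
case: (@arg_maxnP _ a (mem A) f aA) => b; rewrite /= => bA bmax.
have {}bA : b \in A by [].
rewrite (big_setD1 b)//= factS leq_mul//.
  rewrite -An cardE -(size_map f) -[leqRHS](size_iota 1).
  apply: uniq_leq_size; first by rewrite map_inj_uniq ?enum_uniq.
  move=> x /mapP[i]; rewrite mem_enum => iA ->.
  by rewrite mem_iota f0 add1n ltnS; exact: bmax.
by apply: IH; move: (cardsD1 b A); rewrite An bA add1n => -[].
Qed.

Lemma fact_le_fam N m (A : {set prime_le m}) : A \in smooth_fam N m -> (#|A|)`! <= N.
Proof.
rewrite inE; apply: leq_trans; apply: fact_le_prod; first exact: pval_inj.
by move=> p; exact: prime_gt0 (pval_prime p).
Qed.

Lemma expn_le_bin n t : t <= n -> n ^ t <= 'C(n, t) * t ^ t.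
Proof.
move=> tn; rewrite -(leq_pmul2r (fact_gt0 t)) mulnAC bin_ffact -ffactnn.
rewrite !ffact_prod -[X in n ^ X]card_ord -[X in t ^ X]card_ord -!prod_nat_const.
rewrite -!big_split /=; apply: leq_prod => i _.
rewrite mulnBr mulnBl; have := ltn_ord i; nia.
Qed.

Lemma expn_le_fact c R : c ^ R <= c ^ c * R`!.
Proof.
have [->|c0] := posnP c; first by case: R => // R; rewrite exp0n.
have [Rc|cR] := leqP R c.
  by rewrite (leq_trans (leq_pexp2l c0 Rc))// leq_pmulr ?fact_gt0.
elim: R cR => // R IH; rewrite ltnS => cR.
rewrite expnS factS mulnCA leq_mul//; first exact: leqW.
move: cR; rewrite leq_eqVlt => /orP[/eqP <-|/IH//].
by rewrite leq_pmulr ?fact_gt0.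
Qed.

Lemma expn_le_factD t b : t ^ b <= (t + b)`!.
Proof.
elim: b => [|b IH]; first by rewrite fact_gt0.
by rewrite addnS expnS factS leq_mul// -addnS leq_addr.
Qed.

(** The hypothesis [D * t <= pi(m)], where [t] is the integer part of
[log N / log m], encodes [m >= C log N]; the alternative [t = 1] covers the case
[N < m^2], in which it may fail for small [m]. *)
Lemma expn_card_le_fam B : 0 < B -> exists D K, 0 < D /\
  (forall m N, 1 < m -> m <= N ->
  D * trunc_log m N <= #|prime_le m| \/ trunc_log m N = 1 ->
  forall A, A \in smooth_fam N m -> B ^ #|A| <= K * #|smooth_fam N m|).
Proof.
move=> B0; have [m0 hm0] := card_primes_sq.
set K8 := (B ^ 8) ^ (B ^ 8).
have K80 : 0 < K8 by rewrite !expn_gt0 B0.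
exists (B ^ 9), (B ^ 9 + B ^ m0.+1 + K8); split; first by rewrite expn_gt0 B0.
move=> m N m1 mN Dt A AF.
set t := trunc_log m N in Dt *; set j := #|smooth_fam N m|.
have N0 : 0 < N by apply: leq_trans mN; exact: ltnW.
have t0 : 0 < t by rewrite trunc_log_gt0 m1 /=; lia.
have mtN : m ^ t <= N by exact: trunc_logP.
have Nmt : N < m ^ (2 * t).
  by apply: leq_trans (trunc_log_ltn N m1) _; rewrite leq_exp2l//; lia.
have pi0 : 0 < #|prime_le m|.
  by apply/card_gt0P; have [p _] := @pvalP m 2 isT m1; exists p.
have tpi : t <= #|prime_le m|.
  case: Dt => [Dt|->//]; by apply: leq_trans Dt; rewrite leq_pmull// expn_gt0 B0.
have bj := bin_le_card_fam mtN.
have b0 : 0 < 'C(#|prime_le m|, t) by rewrite bin_gt0.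
have j0 : 0 < j by exact: leq_trans bj.
have powt := expn_le_bin tpi.
(* Below [m0] there are boundedly many primes. *)
have [mm0|m0m] := ltnP m m0.
  apply: (@leq_trans (B ^ m0.+1 * j)); last by rewrite leq_mul2r; lia.
  apply: leq_trans (leq_pmulr _ j0); rewrite leq_pexp2l//.
  apply: leq_trans (max_card _) _.
  rewrite card_sub; apply: leq_trans (max_card _) _; rewrite card_ord; lia.
have [Rt|tR] := leqP #|A| (9 * t).
  apply: (@leq_trans (B ^ 9 * j)); last by rewrite leq_mul2r; lia.
  case: Dt => Dt; last first.
    apply: leq_trans (leq_pmulr _ j0); rewrite leq_pexp2l//.
    by move: Rt; rewrite Dt muln1.
  apply: (@leq_trans j); last by rewrite leq_pmull// expn_gt0 B0.
  apply: leq_trans bj.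
  apply: (@leq_trans ((B ^ 9) ^ t)); first by rewrite -expnM leq_pexp2l.
  rewrite -(leq_pmul2r (_ : 0 < t ^ t)) ?expn_gt0 ?t0//.
  by apply: leq_trans powt; rewrite -expnMn; apply: leq_exp2r_w.
have RN := fact_le_fam AF.
(* Here [R > 9t], and [t^(8t) <= (9t)! <= R! < m^(2t)]. *)
have t4m : t ^ 4 < m.
  rewrite -(ltn_exp2r _ _ (isT : 0 < 2)) -expnM -(ltn_exp2r _ _ t0) -!expnM.
  apply: leq_ltn_trans Nmt; apply: leq_trans RN.
  apply: leq_trans (expn_le_factD _ _) _.
  by apply: leq_fact; lia.
have mb : m ^ t <= 'C(#|prime_le m|, t) ^ 4.
  rewrite -(leq_pmul2r (_ : 0 < (t ^ t) ^ 4)) ?expn_gt0 ?t0//.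
  rewrite -expnMn; apply: leq_trans (leq_exp2r_w 4 powt).
  rewrite -!expnM (mulnC t 4) !expnM -expnMn; apply: leq_exp2r_w.
  have := leq_exp2r_w 2 (hm0 m m0m); rewrite -expnM; apply: leq_trans.
  by rewrite -(mulnn m) leq_mul2l ltnW// orbT.
(* It remains to compare eighth powers: [B^(8R) <= K8 R! <= K8 m^(2t)]. *)
apply: (@leq_trans (K8 * j)); last by rewrite leq_mul2r; lia.
apply: (@leq_trans (K8 * 'C(#|prime_le m|, t))); last by rewrite leq_mul2l bj orbT.
rewrite -(leq_exp2r _ _ (isT : 0 < 8)) -expnM mulnC expnM.
apply: leq_trans (expn_le_fact _ _) _; rewrite expnMn leq_mul//.
  by rewrite -{1}(expn1 ((B ^ 8) ^ (B ^ 8))) leq_pexp2l.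
apply: leq_trans RN (leq_trans (ltnW Nmt) _).
rewrite mulnC expnM (expnM _ 4 2 : _ ^ 8 = _).
exact: leq_exp2r_w.
Qed.

Local Open Scope ring_scope.

(** * Moments of a Rademacher chaos *)

Lemma jensen_exprn (R : realFieldType) (a b x y : R) k :
  0 <= a -> 0 <= b -> a + b = 1 -> 0 <= x -> 0 <= y ->
  (a * x + b * y) ^+ k <= a * x ^+ k + b * y ^+ k.
Proof.
move=> a0 b0 ab x0 y0; elim: k => [|k IH]; first by rewrite !expr0 !mulr1 ab.
rewrite exprSr.
apply: (@le_trans _ _ ((a * x ^+ k + b * y ^+ k) * (a * x + b * y))).
  by apply: ler_wpM2r => //; rewrite addr_ge0 ?mulr_ge0.
have xy : 0 <= (x - y) * (x ^+ k - y ^+ k).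
  have [xley|yltx] := leP x y.
    by rewrite mulr_le0// subr_le0// lerXn2r.
  by rewrite mulr_ge0// subr_ge0 ?lerXn2r// ltW.
have aE : a = 1 - b by rewrite -ab addrK.
have := mulr_ge0 (mulr_ge0 a0 b0) xy.
rewrite !exprSr aE -subr_ge0.
set X := x ^+ k; set Y := y ^+ k => h.
rewrite -subr_ge0; suff -> : (1 - b) * (X * x) + b * (Y * y) -
   ((1 - b) * X + b * Y) * ((1 - b) * x + b * y) =
   (1 - b) * b * ((x - y) * (X - Y)) by move: h; rewrite subr0.
ring.
Qed.

(** Minkowski's inequality in [L^k] for nonnegative functions, with the norms
bounded through their [k]-th powers so that no root is needed. *)
Lemma minkowski_sum (R : realFieldType) (S : finType) (u w : S -> R) (M a b : R) k :
  (forall s, 0 <= u s) -> (forall s, 0 <= w s) -> 0 <= a -> 0 <= b ->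
  \sum_s u s ^+ k <= M * a ^+ k -> \sum_s w s ^+ k <= M * b ^+ k ->
  \sum_s (u s + w s) ^+ k <= M * (a + b) ^+ k.
Proof.
case: k => [|k]; first by move=> *; rewrite !expr0.
have zero (f : S -> R) : (forall s, 0 <= f s) ->
    \sum_s f s ^+ k.+1 <= M * 0 ^+ k.+1 -> forall s, f s = 0.
  move=> f0; rewrite expr0n /= mulr0 => sf s.
  have fs : \sum_s f s ^+ k.+1 == 0.
    by rewrite eq_le sf sumr_ge0// => t _; rewrite exprn_ge0.
  move: fs; rewrite psumr_eq0 => [/allP/(_ s)|t _]; last by rewrite exprn_ge0.
  by rewrite mem_index_enum => /(_ isT); rewrite expf_eq0 => /eqP.
move=> u0 w0; rewrite le_eqVlt => /predU1P[<- b0 /(zero _ u0) uz hw|a0].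
  by rewrite add0r; under eq_bigr do rewrite uz add0r.
rewrite le_eqVlt => /predU1P[<- hu /(zero _ w0) wz|b0].
  by rewrite addr0; under eq_bigr do rewrite wz addr0.
move=> hu hw; have ab0 : 0 < a + b by exact: addr_gt0.
have pt s : (u s + w s) ^+ k.+1 <= (a + b) ^+ k.+1 *
    (a / (a + b) * (u s ^+ k.+1 / a ^+ k.+1) + b / (a + b) * (w s ^+ k.+1 / b ^+ k.+1)).
  rewrite -!expr_div_n.
  have -> : u s + w s = (a + b) * (a / (a + b) * (u s / a) + b / (a + b) * (w s / b)).
    by field; rewrite !gt_eqF.
  rewrite exprMn ler_wpM2l ?exprn_ge0 ?(ltW ab0)//.
  apply: jensen_exprn; rewrite ?divr_ge0 ?(ltW a0) ?(ltW b0) ?(ltW ab0)//.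
  by rewrite -mulrDl divff ?gt_eqF.
apply: le_trans (ler_sum _ (fun s _ => pt s)) _.
rewrite -big_distrr /= mulrC big_split /= -!big_distrr -!big_distrl /=.
rewrite ler_wpM2r ?exprn_ge0 ?(ltW ab0)//.
have ha : \sum_s u s ^+ k.+1 / a ^+ k.+1 <= M.
  by rewrite -big_distrl /= ler_pdivrMr ?exprn_gt0.
have hb : \sum_s w s ^+ k.+1 / b ^+ k.+1 <= M.
  by rewrite -big_distrl /= ler_pdivrMr ?exprn_gt0.
rewrite !big_distrl /=.
have -> : M = a / (a + b) * M + b / (a + b) * M.
  by rewrite -!mulrDl divff ?gt_eqF// mul1r.
by rewrite lerD// ler_wpM2l// divr_ge0 ?(ltW a0) ?(ltW b0) ?(ltW ab0).
Qed.

(** The two-point hypercontractive inequality.  The second bound, on the odd part,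
only serves the induction on [k]. *)
Lemma two_point (R : realFieldType) (g h a : R) k : (4 * k)%:R + 1 <= a ->
  ((g + h) ^+ (2 * k) + (g - h) ^+ (2 * k)) / 2 <= (g ^+ 2 + a * h ^+ 2) ^+ k /\
  g * h * ((g + h) ^+ (2 * k) - (g - h) ^+ (2 * k)) <=
    (4 * k)%:R * h ^+ 2 * (g ^+ 2 + a * h ^+ 2) ^+ k.
Proof.
elim: k => [|k IH] ka.
  by rewrite !muln0 !expr0 subrr mulr0n mulr0 !mul0r; split => //; lra.
have k0 : 0 <= (4 * k)%:R :> R by [].
have kS : (4 * k.+1)%:R = (4 * k)%:R + 4 :> R by rewrite mulnS natrD addrC.
have [] := IH ltac:(lra).
have sq0 : 0 <= h ^+ 2 by exact: sqr_ge0.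
have sq1 : 0 <= g ^+ 2 by exact: sqr_ge0.
have a0 : 0 <= a by lra.
have ah : (4 * k)%:R * h ^+ 2 + h ^+ 2 <= a * h ^+ 2.
  by rewrite -{2}(mul1r (h ^+ 2)) -mulrDl; apply: ler_wpM2r => //; lra.
rewrite kS; move: ((4 * k)%:R : R) k0 ah {IH ka kS} => c c0 ah.
have Wk0 : 0 <= (g ^+ 2 + a * h ^+ 2) ^+ k by rewrite exprn_ge0// addr_ge0// mulr_ge0.
move: Wk0; rewrite !(exprM _ 2) !exprS.
move: ((_ + _) ^+ k) (((g + h) * _) ^+ k) (((g - h) * _) ^+ k) => Wk X Y Wk0 hS hE.
rewrite expr0 !mulr1 in sq0 sq1 ah hS hE *.
set W := g * g + a * (h * h).
split.
  have -> : ((g + h) * (g + h) * X + (g - h) * (g - h) * Y) / 2 =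
     (g * g + h * h) * ((X + Y) / 2) + g * h * (X - Y) by field.
  have h1 : (g * g + h * h) * ((X + Y) / 2) <= (g * g + h * h) * Wk.
    by apply: ler_wpM2l => //; exact: addr_ge0.
  have h2 : (c * (h * h) + h * h) * Wk <= a * (h * h) * Wk by apply: ler_wpM2r.
  rewrite /W; lra.
have -> : g * h * ((g + h) * (g + h) * X - (g - h) * (g - h) * Y) =
   (g * g + h * h) * (g * h * (X - Y)) + 4 * ((g * g) * (h * h)) * ((X + Y) / 2).
  by field.
have h1 : (g * g + h * h) * (g * h * (X - Y)) <= (g * g + h * h) * (c * (h * h) * Wk).
  by apply: ler_wpM2l => //; exact: addr_ge0.
have h2 : 4 * ((g * g) * (h * h)) * ((X + Y) / 2) <= 4 * ((g * g) * (h * h)) * Wk.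
  by apply: ler_wpM2l => //; apply: mulr_ge0 => //; exact: mulr_ge0.
have h3 : (h * h) * (c * (h * h) * Wk) <= (a * (h * h)) * (c * (h * h) * Wk).
  apply: ler_wpM2r; first exact: mulr_ge0 (mulr_ge0 c0 sq0) Wk0.
  by have := mulr_ge0 c0 sq0; lra.
have h4 : 0 <= 4 * (h * h) * (a * (h * h) * Wk).
  by apply: mulr_ge0; apply: mulr_ge0 => //; exact: mulr_ge0.
rewrite /W.
have -> : (c + 4) * (h * h) * ((g * g + a * (h * h)) * Wk) =
  (g * g) * (c * (h * h) * Wk) + (a * (h * h)) * (c * (h * h) * Wk) +
  4 * ((g * g) * (h * h)) * Wk + 4 * (h * h) * (a * (h * h) * Wk) by ring.
lra.
Qed.

(** Induction on a set of variables containing the support: isolating one variable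
writes the polynomial as [g + e h]; averaging over the sign [e] is the two-point
inequality, and Minkowski's inequality combines the bounds for [g] and [h]. *)
Lemma chaos_moment (R : realFieldType) (I : finType) k (F : {set {set I}}) :
  \sum_(s : {ffun I -> bool}) (\sum_(A in F) \prod_(i in A) (-1) ^+ s i) ^+ (2 * k)
  <= 2 ^+ #|I| * (\sum_(A in F) (4 * k).+1%:R ^+ #|A|) ^+ k :> R.
Proof.
pose f (F : {set {set I}}) (s : {ffun I -> bool}) : R :=
  \sum_(A in F) \prod_(i in A) (-1) ^+ s i.
pose a : R := (4 * k).+1%:R.
have a0 : 0 <= a by [].
have [n] := ubnP #|[set: I]|.
have : forall A, A \in F -> A \subset [set: I] by move=> A _; exact: finset.subsetT.
elim: n [set: I] F => [//|n IH] J F FJ; rewrite ltnS => Jn.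
have [J0|[p pJ]] := set_0Vmem J.
  have Fset A : A \in F -> A = finset.set0.
    by move=> /FJ; rewrite J0 finset.subset0 => /eqP.
  have fc s : \sum_(A in F) \prod_(i in A) (-1) ^+ (s : {ffun I -> bool}) i = #|F|%:R :> R.
    rewrite (eq_bigr (fun _ => 1)) ?sumr_const// => A /Fset ->.
    by rewrite big_set0.
  have -> : \sum_(A in F) (4 * k).+1%:R ^+ #|A| = #|F|%:R :> R.
    rewrite (eq_bigr (fun _ => 1)) ?sumr_const// => A /Fset ->.
    by rewrite cards0.
  under eq_bigr do rewrite fc.
  rewrite sumr_const card_ffun card_bool -[leLHS]mulr_natl natrX.
  apply: ler_wpM2l; first by rewrite exprn_ge0.
  have : (#|F| <= 1)%N.
    have /fintype.subset_leq_card : F \subset finset.set1 finset.set0.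
      by apply/fintype.subsetP => A /Fset ->; rewrite finset.in_set1.
    by rewrite cards1.
  case: #|F| => [|[|//]] _; last by rewrite !expr1n.
  by case: (k) => // q; rewrite !expr0n.
pose F0 := [set A in F | p \notin A].
pose Fp := [set A in F | p \in A].
pose F1 := [set A :\ p | A in Fp].
have split (G : {set I} -> R) : \sum_(A in F) G A =
    \sum_(A in F0) G A + \sum_(B in F1) G (p |: B).
  rewrite (bigID (fun A : {set I} => p \in A)) /= addrC; congr +%R.
    by apply: eq_bigl => A; rewrite !inE.
  rewrite big_imset /= => [|A B]; last first.
    rewrite !inE => /andP[_ pA] /andP[_ pB] AB.
    by rewrite -(finset.setD1K pA) AB finset.setD1K.
  rewrite [RHS](eq_bigr G) => [|A]; last first.
    by rewrite inE => /andP[_ pA]; rewrite finset.setD1K.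
  by apply: eq_bigl => A; rewrite !inE.
have pF0 B : B \in F0 -> p \notin B by rewrite inE => /andP[].
have pF1 B : B \in F1 -> p \notin B.
  by case/imsetP => A _ ->; rewrite !inE eqxx.
have fE s : f F s = f F0 s + (-1) ^+ s p * f F1 s.
  rewrite /f split big_distrr /=; congr +%R; apply: eq_bigr => B /pF1 pB.
  by rewrite big_setU1.
(* Pair each pattern with the one differing from it in the sign of [p]. *)
pose fl (s : {ffun I -> bool}) := [ffun i => s i (+) (i == p)].
have flK : involutive fl.
  by move=> s; apply/ffunP => i; rewrite !ffunE addbK.
have flip (G : {ffun I -> bool} -> R) : \sum_s G s = \sum_s (G s + G (fl s)) / 2.
  rewrite -big_distrl big_split /=.
  have <- : \sum_s G s = \sum_s G (fl s) by rewrite (reindex_inj (inv_inj flK)).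
  by field.
have flip0 (H : {set {set I}}) s : (forall B, B \in H -> p \notin B) -> f H (fl s) = f H s.
  move=> pH; apply: eq_bigr => A /pH pA; apply: eq_bigr => i iA.
  rewrite ffunE; case: eqVneq => [ip|_]; last by rewrite addbF.
  by rewrite -ip iA in pA.
have pt s : (f F s ^+ (2 * k) + f F (fl s) ^+ (2 * k)) / 2 <=
    (f F0 s ^+ 2 + a * f F1 s ^+ 2) ^+ k.
  rewrite !fE !flip0// !ffunE eqxx addbT signrN mulNr.
  have ka : (4 * k)%:R + 1 <= a by rewrite natr1.
  have [+ _] := two_point (f F0 s) (f F1 s) ka; case: (s p) => /=.
    by rewrite expr1 mulN1r opprK addrC.
  by rewrite expr0 mul1r.
have sub0 A : A \in F0 -> A \subset J :\ p.
  by rewrite inE => /andP[AF pA]; rewrite finset.subsetD1 pA FJ.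
have sub1 A : A \in F1 -> A \subset J :\ p.
  by case/imsetP => B; rewrite inE => /andP[BF _] ->; apply/finset.setSD/FJ.
have Jp : (#|J :\ p| < n)%N by move: Jn; rewrite (cardsD1 p) pJ.
rewrite -/(f F) flip; apply: le_trans (ler_sum _ (fun s _ => pt s)) _.
rewrite split; apply: minkowski_sum.
- by move=> s; exact: sqr_ge0.
- by move=> s; rewrite mulr_ge0 ?sqr_ge0.
- by rewrite sumr_ge0// => A _; rewrite exprn_ge0.
- by rewrite sumr_ge0// => A _; rewrite exprn_ge0.
- under eq_bigr do rewrite -exprM; exact: IH sub0 Jp.
- under eq_bigr do rewrite exprMn -exprM.
  rewrite -big_distrr /=.
  rewrite (eq_bigr (fun A : {set I} => a * a ^+ #|A|)) => [|A /pF1 pA]; last first.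
    by rewrite cardsU1 pA add1n exprS.
  rewrite -big_distrr exprMn mulrCA ler_wpM2l ?exprn_ge0//.
  exact: IH sub1 Jp.
Qed.

(** * The sums over smooth integers as sums over families of sets of primes *)

Lemma logn_prod_pval m (A : {set prime_le m}) q :
  logn q (\prod_(p in A) pval p) = (q \in [seq pval p | p <- enum A]).
Proof.
have -> : logn q (\prod_(p in A) pval p) = (\sum_(p in A) (q == pval p))%N.
  suff [] : (0 < \prod_(p in A) pval p)%N /\
      logn q (\prod_(p in A) pval p) = (\sum_(p in A) (q == pval p))%N by [].
  elim/big_rec2: _ => [|p s n _ [n0 <-]]; first by rewrite logn1.
  have pP := pval_prime p; have p0 := prime_gt0 pP.
  by rewrite muln_gt0 p0 n0 lognM// logn_prime.
have [/mapP[p]|nA] := boolP (q \in _).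
  rewrite mem_enum => pA ->; rewrite (bigD1 p)//= eqxx big1 ?addn0// => r /andP[_ rp].
  by rewrite eq_sym (inj_eq (@pval_inj m)) (negbTE rp).
rewrite big1// => p pA; case: eqP => // qp.
by rewrite qp map_f ?mem_enum in nA.
Qed.

Lemma prod_pval_gt0 m (A : {set prime_le m}) : (0 < \prod_(p in A) pval p)%N.
Proof. by apply: prodn_gt0 => p; exact: prime_gt0 (pval_prime p). Qed.

Lemma primes_prod_pval m (A : {set prime_le m}) :
  perm_eq (primes (\prod_(p in A) pval p)%N) [seq pval p | p <- enum A].
Proof.
apply: uniq_perm; first exact: primes_uniq.
  by rewrite map_inj_uniq ?enum_uniq//; exact: pval_inj.
by move=> q; rewrite -logn_gt0 logn_prod_pval lt0b.
Qed.

Lemma moebius_prod_pval m (A : {set prime_le m}) :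
  moebius (\prod_(p in A) pval p)%N ^+ 2 = 1.
Proof.
rewrite /moebius prod_pval_gt0 /= ifT; first by rewrite sqrr_sign.
by apply/allP => q qA; rewrite logn_prod_pval -(perm_mem (primes_prod_pval A)) qA.
Qed.

Lemma prod_pval_inj m : injective (fun A : {set prime_le m} => \prod_(p in A) pval p)%N.
Proof.
move=> A B /= AB; apply/setP => p.
have := congr1 (fun n => logn (pval p) n) AB; rewrite !logn_prod_pval.
by rewrite !(mem_map (@pval_inj m)) !mem_enum; do 2!case: (p \in _).
Qed.

Lemma moebius_neq0_prod n m : moebius n != 0 -> (max_pdiv n <= m)%N ->
  exists A : {set prime_le m}, n = (\prod_(p in A) pval p)%N.
Proof.
rewrite /moebius; case: ifP => [/andP[n0 /allP sqf] _ nm|]; last by rewrite eqxx.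
pose A := [set p : prime_le m | pval p \in primes n]; exists A.
rewrite {1}(prod_prime_decomp n0) prime_decompE big_map /=.
rewrite (eq_big_seq id) => [|p /sqf/eqP ->]; last by rewrite expn1.
rewrite -big_enum -[RHS](big_map (@pval m) predT id) /=; apply: perm_big.
apply: uniq_perm; first exact: primes_uniq.
  by rewrite map_inj_uniq ?enum_uniq//; exact: pval_inj.
move=> q; apply/idP/mapP => [qn|[p]]; last by rewrite mem_enum inE => pA ->.
have [qP qm] : prime q /\ (q <= m)%N.
  move: (qn); rewrite mem_primes => /andP[-> _]; split => //.
  by apply: leq_trans nm; exact: max_pdiv_max.
have [p pq] := pvalP qP qm; exists p => //.
by rewrite mem_enum inE pq.
Qed.

(** The hypothesis [1 <= y] is needed for [n = 1], whose largest prime factor is 1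
by convention. *)
Lemma Psi_famE (R : realType) (X : nat -> R) (x y : R) : 0 <= x -> 1 <= y ->
  Psi (fun n => (moebius n ^+ 2)%:~R * \prod_(p <- primes n) X p) x y =
  \sum_(A in smooth_fam (Num.truncn x) (Num.truncn y)) \prod_(p in A) X (pval p).
Proof.
move=> x0 y1; rewrite /Psi.
set N := Num.truncn x; set m := Num.truncn y; set G := fun n => _.
pose v (A : {set prime_le m}) := (\prod_(p in A) pval p)%N.
pose r := [seq v A | A <- enum (smooth_fam N m)].
have y0 : 0 <= y by exact: le_trans y1.
have ur : uniq r by rewrite map_inj_uniq ?enum_uniq//; exact: prod_pval_inj.
rewrite -(@fsbig_widen _ _ _ _ [set` r]%classic (smooth_set x y)).
- rewrite -fsbig_seq// big_map big_enum /=; apply: eq_bigr => A _.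
  rewrite /G moebius_prod_pval mul1r (perm_big _ (primes_prod_pval A)).
  by rewrite big_map big_enum.
- move=> n /= /mapP[A]; rewrite mem_enum inE => AN ->; split.
  + exact: prod_pval_gt0.
  + by rewrite -truncn_ge_nat.
  + rewrite -truncn_ge_nat//.
    have [vA|] := ltnP 1 (v A); last first.
      case E : (v A) (prod_pval_gt0 A) => [|[|//]]; rewrite -/(v A) E// => _ _.
      by rewrite -/m /max_pdiv /= truncn_ge_nat.
    have := pi_max_pdiv (v A); rewrite vA -[_ \in _]/(_ \in primes (v A)).
    rewrite (perm_mem (primes_prod_pval A)) => /mapP[p _ ->].
    exact: pval_le.
- move=> n [[n0 nx ny] nr] /=; rewrite /G.
  have [->|mn0] := eqVneq (moebius n) 0; first by rewrite expr0n mul0r.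
  have := @moebius_neq0_prod n m mn0; rewrite truncn_ge_nat// => /(_ ny)[A nA].
  case: nr; apply/mapP; exists A => //.
  by rewrite mem_enum inE -nA truncn_ge_nat.
Qed.

Lemma Psi_starE (R : realType) (x y : R) : 0 <= x -> 1 <= y ->
  Psi_star x y = #|smooth_fam (Num.truncn x) (Num.truncn y)|%:R.
Proof.
move=> x0 y1; have := @Psi_famE R (fun=> 1) x y x0 y1.
under [RHS]eq_bigr do rewrite big1//; rewrite sumr_const => <-.
rewrite /Psi_star; congr Psi; apply/funext => n.
by rewrite big1// mulr1.
Qed.

Lemma Psi_le (R : realType) (g : nat -> R) (x y : R) : x <= y -> Psi g x y = Psi g x x.
Proof.
move=> xy; rewrite /Psi (_ : smooth_set x y = smooth_set x x)//.
apply/seteqP; split => n [n0 nx ny].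
  by split => //; apply: le_trans nx; rewrite ler_nat max_pdiv_leq.
by split => //; exact: le_trans xy.
Qed.

(** * The moment bound along the families *)

(** The constant 6 is the 3 of the Chebyshev bound times the 2 of [y <= 2 m]. *)
Lemma trunc_log_le_primes (R : realType) (D : nat) (x y : R) :
  2 <= y -> y <= x -> (6 * D)%:R / ln 2 * ln x <= y ->
  (D * trunc_log (Num.truncn y) (Num.truncn x) <= #|prime_le (Num.truncn y)|)%N.
Proof.
move=> y2 yx; set m := Num.truncn y; set N := Num.truncn x => Dxy.
have y0 : 0 <= y by lra.
have x0 : 0 <= x by lra.
have m1 : (1 < m)%N by rewrite truncn_ge_nat.
have N1 : (1 < N)%N by rewrite truncn_ge_nat//; lra.
have ln20 : 0 < ln 2 :> R by apply: ln_gt0; lra.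
have lnm0 : 0 < ln m%:R :> R by apply: ln_gt0; rewrite ltr1n.
set t := trunc_log m N.
have tlog : t%:R * ln m%:R <= ln x.
  rewrite mulr_natl -lnXn ?ltr0n ?(ltnW m1)// -natrX.
  rewrite ler_ln ?posrE ?ltr0n ?expn_gt0 ?(ltnW m1)//; last lra.
  by rewrite -truncn_ge_nat// trunc_logP// ltnW.
have cheb : m%:R * ln 2 <= 3 * #|prime_le m|%:R * ln m%:R :> R.
  have : ln (2 ^+ m) <= ln (m%:R ^+ (3 * #|prime_le m|)) :> R.
    rewrite ler_ln ?posrE ?exprn_gt0 ?ltr0n// ?(ltnW m1)//.
    by rewrite -!natrX ler_nat; exact: card_primes_lower.
  by rewrite !lnXn ?ltr0n ?(ltnW m1)// -natrM !mulr_natl.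
have ym : y <= 2 * m%:R.
  have /ltW := truncnS_gt y; rewrite -/m -natr1 => h.
  have : 1 <= m%:R :> R by rewrite ler1n ltnW.
  lra.
rewrite -(ler_nat R) natrM -(ler_pM2r lnm0).
have h1 : D%:R * (t%:R * ln m%:R) <= D%:R * ln x :> R by apply: ler_wpM2l.
have h2 : 6 * D%:R * ln x <= y * ln 2.
  by move: Dxy; rewrite mulrAC ler_pdivrMr// natrM.
have h3 : y * ln 2 <= 2 * m%:R * ln 2 by apply: ler_wpM2r => //; exact: ltW.
lra.
Qed.

Lemma fam_mono m N N' : (N <= N')%N -> smooth_fam N m \subset smooth_fam N' m.
Proof.
by move=> NN'; apply/fintype.subsetP => A; rewrite !inE => /leq_trans; exact.
Qed.

(** For fixed [m] the families increase with [N], so their size determines them. *)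
Lemma fam_eq m N N' :
  #|smooth_fam N m| = #|smooth_fam N' m| -> smooth_fam N m = smooth_fam N' m.
Proof.
move=> NN'; apply/eqP; have [h|/ltnW h] := leqP N N'.
  by rewrite finset.eqEcard fam_mono//= NN'.
by rewrite eq_sym finset.eqEcard fam_mono//= NN'.
Qed.

Lemma card_fam_gt0 m N : (0 < N)%N -> (0 < #|smooth_fam N m|)%N.
Proof.
by move=> N0; apply/card_gt0P; exists finset.set0; rewrite inE big_set0.
Qed.

(** The sum is bounded by its number of terms times the largest one, to which the
hypothesis applies. *)
Lemma moment_weight_le (K k c N m : nat) : (0 < N)%N ->
  (forall A, A \in smooth_fam N m -> (c ^ k) ^ #|A| <= K * #|smooth_fam N m|)%N ->
  (0 < c)%N ->
  ((\sum_(A in smooth_fam N m) c ^ #|A|) ^ k <= K * #|smooth_fam N m| ^ k.+1)%N.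
Proof.
move=> N0 hK c0.
have /card_gt0P[A0 A0F] := card_fam_gt0 m N0.
case: (@arg_maxnP _ A0 (mem (smooth_fam N m)) (fun A : {set _} => #|A|) A0F) => A AF Amax.
apply: (@leq_trans ((#|smooth_fam N m| * c ^ #|A|) ^ k)%N).
  apply: leq_exp2r_w; rewrite -sum_nat_const; apply: leq_sum => B BF.
  by rewrite leq_pexp2l//; exact: Amax.
have AK : (c ^ (#|A| * k) <= K * #|smooth_fam N m|)%N.
  by rewrite mulnC expnM; exact: hK.
by rewrite expnMn -expnM expnSr mulnCA leq_mul2l AK orbT.
Qed.

(** Markov's inequality for the [2k]-th moment, when all sign patterns are equally
likely. *)
Lemma large_patterns_le (R : realType) (I : finType) (F : {set {set I}})
    (k K j : nat) (eps l : R) :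
  5 <= (2 * k)%:R * eps -> l = j%:R `^ (2^-1 + eps) -> (0 < j)%N ->
  ((\sum_(A in F) (4 * k).+1 ^ #|A|) ^ k <= K * j ^ k.+1)%N ->
  #|[set s : {ffun I -> bool} |
      l < `|\sum_(A in F) \prod_(i in A) (-1) ^+ s i|]%SET|%:R / 2 ^+ #|I|
  <= K%:R / j%:R ^+ 4 :> R.
Proof.
move=> keps lE j0 hK; set Bad := finset _.
have j1 : 1 <= j%:R :> R by rewrite ler1n.
have l0 : 0 <= l by rewrite lE powR_ge0.
have lk : j%:R ^+ (k + 5) <= l ^+ (2 * k).
  rewrite lE -powR_mulrn ?powR_ge0// -powRrM -powR_mulrn//.
  apply: ler_powR => //; rewrite mulrDl natrD natrM.
  move: keps; rewrite natrM; lra.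
have : #|Bad|%:R * l ^+ (2 * k) <= 2 ^+ #|I| * (K%:R * j%:R ^+ k.+1).
  apply: le_trans (_ : _ <=
    2 ^+ #|I| * (\sum_(A in F) (4 * k).+1%:R ^+ #|A|) ^+ k) _; last first.
    rewrite ler_wpM2l ?exprn_ge0//.
    move: hK; rewrite -(ler_nat R) natrX natrM natrX natr_sum.
    by under eq_bigr do rewrite natrX.
  apply: le_trans (chaos_moment R k F).
  rewrite [leRHS](bigID (mem Bad)) /= -[leLHS]addr0 lerD//; last first.
    by rewrite sumr_ge0// => s _; rewrite exprM exprn_ge0// sqr_ge0.
  rewrite mulr_natl -sumr_const; apply: ler_sum => s.
  rewrite inE => /ltW ls; rewrite -[leRHS]ger0_norm; last first.
    by rewrite exprM exprn_ge0// sqr_ge0.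
  by rewrite normrX lerXn2r// nnegrE.
move=> h; rewrite ler_pdivrMr ?exprn_gt0// mulrAC ler_pdivlMr ?exprn_gt0 ?ltr0n//.
rewrite -(@ler_pM2r _ (j%:R ^+ k.+1)) ?exprn_gt0 ?ltr0n//.
rewrite -mulrA -exprD (_ : 4 + k.+1 = k + 5)%N; last by lia.
apply: le_trans (le_trans h _); first by rewrite ler_wpM2l.
by rewrite mulrCA mulrA.
Qed.

(** * Probabilities of sign patterns *)

Local Open Scope classical_set_scope.
Local Open Scope ring_scope.

(** The event that the signs at the primes up to [m] follow the pattern [s], where
[true] stands for the sign -1. *)
Definition cylinder d (T : measurableType d) (R : realType) (P : probability T R)
    (X : nat -> {RV P >-> R}) m (s : {ffun prime_le m -> bool}) : set T :=
  [set w | forall p, X (pval p) w = (-1) ^+ s p].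

Lemma cylinder_proba d (T : measurableType d) (R : realType) (P : probability T R)
    (X : nat -> {RV P >-> R}) m (s : {ffun prime_le m -> bool}) : prime_signs X ->
  measurable (cylinder X s) /\ P (cylinder X s) = ((2 ^+ #|prime_le m|)^-1)%:E.
Proof.
move=> [Xind Xsign].
(* The pattern extended to all natural numbers; the default value is irrelevant. *)
pose c i : bool := if [pick p : prime_le m | pval p == i] is Some p then s p else false.
have cE p : c (pval p) = s p.
  rewrite /c; case: pickP => [q /eqP /pval_inj -> //|/(_ p)].
  by rewrite eqxx.
pose J : {fset nat} := [fset i in [seq pval p | p <- enum (prime_le m)]]%fset.
pose B i : set R := [set (-1) ^+ c i].
have JP i : i \in J -> exists p : prime_le m, i = pval p.
  by rewrite inE => /mapP[p _ ->]; exists p.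
have cylE : cylinder X s = \bigcap_(i in [set` J]) (X i @^-1` B i).
  apply/seteqP; split => w /= sw.
    by move=> i /= /JP[p ->]; rewrite /B cE; exact: sw.
  move=> p; rewrite -cE; apply: (sw (pval p)) => /=.
  by rewrite !inE map_f// mem_enum.
have mB i : i \in J -> measurable (B i) by move=> _; exact: measurable_set1.
split.
  rewrite cylE; apply: fin_bigcap_measurable; first exact: finite_fset.
  move=> i /= iJ; rewrite -[_ @^-1` _]setTI.
  by apply: (measurable_funP (X i)) => //; exact: mB.
rewrite cylE Xind//; last by move=> i /JP[p ->]; exact: pval_prime.
rewrite (perm_big [seq pval p | p <- enum (prime_le m)]) /=; last first.
  apply: uniq_perm; first exact: fset_uniq.
    by rewrite map_inj_uniq ?enum_uniq//; exact: pval_inj.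
  by move=> i; rewrite inE.
rewrite big_map big_enum /= (eq_bigr (fun=> (2^-1)%:E)) => [|p _]; last first.
  have [h1 h2] := Xsign _ (pval_prime p).
  by rewrite /B cE; case: (s p); rewrite ?expr1 ?expr0.
have -> : #|prime_le m| = size (enum (prime_le m)) by rewrite cardE.
rewrite -big_enum /=; elim: (enum _) => [|p r IH]; first by rewrite big_nil expr0 invr1.
by rewrite big_cons IH -EFinM exprS invfM.
Qed.

Lemma bigcup_cylinder_proba d (T : measurableType d) (R : realType) (P : probability T R)
    (X : nat -> {RV P >-> R}) m (B : {set {ffun prime_le m -> bool}}) : prime_signs X ->
  measurable (\bigcup_(s in [set` B]) cylinder X s) /\
  (P (\bigcup_(s in [set` B]) cylinder X s) <= (#|B|%:R / 2 ^+ #|prime_le m|)%:E)%E.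
Proof.
move=> sX; have cp (s : {ffun prime_le m -> bool}) := cylinder_proba s sX.
rewrite bigcup_pred; split; first by apply: bigsetU_measurable => s _; exact: (cp s).1.
suff [] : measurable (\big[setU/set0]_(s in B) cylinder X s) /\
    (P (\big[setU/set0]_(s in B) cylinder X s) <=
     (\sum_(s in B) (2 ^+ #|prime_le m|)^-1)%:E)%E.
  by move=> _; rewrite sumr_const mulr_natl.
elim/big_rec2: _ => [|s r A _ [mA PA]]; first by rewrite measure0; split.
have [ms Ps] := cp s; split; first exact: measurableU.
have {}Ps : (P (cylinder X s) <= ((2 ^+ #|prime_le m|)^-1)%:E)%E by rewrite Ps.
by apply: le_trans (measureU2 _ ms mA) _; rewrite EFinD; exact: leeD.
Qed.

Lemma prime_signs_ae d (T : measurableType d) (R : realType) (P : probability T R)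
    (X : nat -> {RV P >-> R}) : prime_signs X ->
  {ae P, forall w, forall p, prime p -> X p w = 1 \/ X p w = -1}.
Proof.
have n11 : (1 : R) <> -1 by move=> h; lra.
move=> [_ Xsign]; apply/ae_foralln => p.
have [pP|npP] := boolP (prime p); last by apply: aeW => w pP; case/negP: npP.
have [h1 h2] := Xsign p pP.
have mX (a : R) : measurable (X p @^-1` [set a]).
  by rewrite -[_ @^-1` _]setTI; apply: (measurable_funP (X p)).
exists (~` (X p @^-1` [set 1] `|` X p @^-1` [set -1])); split.
- by apply: measurableC; exact: measurableU.
- have disj : X p @^-1` [set 1] `&` X p @^-1` [set -1] = set0.
    by apply/seteqP; split => // w /= [-> /n11].
  have PU : P (X p @^-1` [set 1] `|` X p @^-1` [set -1]) = 1%:E.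
    apply: etrans (measureU P (mX 1) (mX (-1)) disj) _.
    apply: etrans (congr2 (fun u v => u + v)%E h1 h2) _.
    by rewrite -EFinD; congr EFin; field.
  apply: etrans (probability_setC P (measurableU _ _ (mX 1) (mX (-1)))) _.
  by apply: etrans (congr1 (fun z => 1 - z)%E PU) _; rewrite -EFinB subrr.
- by apply: subsetC => w /= ? _.
Qed.

(** * Borel-Cantelli and the conclusion *)

(** The pairs of integer parts of ([y], [x]), with [y <= x], to which the bound on
[B^omega(n)] applies. *)
Definition admissible (D m N : nat) : Prop :=
  [/\ (1 < m)%N, (m <= N)%N &
      (D * trunc_log m N <= #|prime_le m|)%N \/ trunc_log m N = 1%N].

(** The sign patterns on the primes up to [m] for which some admissible family with
[j] elements has a sum larger than [j^(1/2+eps)].  By [fam_eq] there is at most one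
such family. *)
Definition bad_patterns (R : realType) (D : nat) (eps : R) (m j : nat) :
    {set {ffun prime_le m -> bool}} :=
  [set s : {ffun prime_le m -> bool} | `[< exists N,
    [/\ admissible D m N, #|smooth_fam N m| = j &
      j%:R `^ (2^-1 + eps) <
        `|\sum_(A in smooth_fam N m) \prod_(p in A) (-1) ^+ s p| :> R] >]]%SET.

(** The last clause bounds the values of [m] relevant to a family of given size. *)
Lemma bad_bounds (R : realType) (eps : R) : 0 < eps ->
  exists D K m0 : nat, [/\ (0 < D)%N,
    (forall m j, (0 < j)%N ->
       #|bad_patterns D eps m j|%:R / 2 ^+ #|prime_le m| <= K%:R / j%:R ^+ 4 :> R) &
    (forall m N, admissible D m N -> m <= #|smooth_fam N m| ^ 2 + m0)%N].
Proof.
move=> eps0.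
pose k := (Num.truncn (5 / eps)).+1.
have keps : 5 <= (2 * k)%:R * eps.
  have /ltW := truncnS_gt (5 / eps); rewrite ler_pdivrMr// -/k => h.
  by apply: le_trans h _; rewrite ler_pM2r// ler_nat leq_pmull.
have c0 : (0 < (4 * k).+1 ^ k)%N by rewrite expn_gt0.
have [D [K [D0 hK]]] := expn_card_le_fam c0.
have [m0 hm0] := card_primes_sq.
exists D, K, m0; split => //.
- move=> m j j0.
  have [[s0]|none] := pselect (exists s, s \in bad_patterns D eps m j); last first.
    rewrite (_ : bad_patterns _ _ _ _ = finset.set0) ?cards0 ?mul0r ?divr_ge0 ?exprn_ge0//.
    apply/setP => s; rewrite finset.in_set0; apply/negP => sb.
    by apply: none; exists s.
  rewrite inE => /asboolP[N [adm NJ _]].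
  have [m1 mN Dt] := adm.
  have N0 : (0 < N)%N by lia.
  have hw := moment_weight_le N0 (hK m N m1 mN Dt) isT.
  rewrite NJ in hw.
  have := large_patterns_le keps erefl j0 hw.
  apply: le_trans; rewrite ler_wpM2r ?invr_ge0 ?exprn_ge0// ler_nat.
  apply: subset_leq_card; apply/fintype.subsetP => s.
  rewrite inE => /asboolP[N' [_ N'J]]; rewrite inE.
  by have -> : smooth_fam N' m = smooth_fam N m by apply: fam_eq; rewrite N'J.
- move=> m N [m1 mN _].
  have [h|h] := leqP m0 m; last by rewrite (leq_trans (ltnW h))// leq_addl.
  apply: leq_trans (leq_addr _ _); apply: leq_trans (hm0 m h) _.
  apply: leq_exp2r_w; rewrite -[leqLHS]bin1; apply: bin_le_card_fam.
  by rewrite expn1.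
Qed.

Lemma nneseries_inv_sq_lty (R : realType) (u : nat -> \bar R) (K : R) :
  (forall j, 0 <= u j)%E -> (forall j, u j <= (K / j.+1%:R ^+ 2)%:E)%E -> 0 <= K ->
  (\sum_(j <oo) u j < +oo)%E.
Proof.
move=> u0 uK K0; apply: (@le_lt_trans _ _ (2 * K)%:E); last exact: ltry.
apply: lime_le; first exact: is_cvg_nneseries.
apply: nearW => n; apply: (@le_trans _ _ (K * (2 - 2 / n.+1%:R))%:E); last first.
  by rewrite lee_fin mulrC ler_wpM2r// lerBlDr lerDl divr_ge0.
elim: n => [|n IH].
  by rewrite big_nil invr1 mulr1 subrr mulr0.
rewrite big_nat_recr//=; apply: le_trans (leeD IH (uK n)) _.
rewrite -EFinD lee_fin -mulrDr ler_wpM2l//.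
have -> : n.+2%:R = n.+1%:R + 1 :> R by rewrite natr1.
have : 1 <= n.+1%:R :> R by rewrite ler1n.
move: (n.+1%:R : R) => z z1.
rewrite -subr_ge0.
have -> : 2 - 2 / (z + 1) - (2 - 2 / z + (z ^+ 2)^-1) = (z - 1) / (z ^+ 2 * (z + 1)).
  by field; apply/andP; split; lra.
by rewrite divr_ge0 ?mulr_ge0 ?exprn_ge0; lra.
Qed.

(** At one of the relevant levels [m], some sum of [j + 1] terms is too large. *)
Definition bad_event d (T : measurableType d) (R : realType) (P : probability T R)
    (X : nat -> {RV P >-> R}) (D m0 : nat) (eps : R) (j : nat) : set T :=
  \bigcup_(m in `I_(j.+1 ^ 2 + m0).+1)
    \bigcup_(s in [set` bad_patterns D eps m j.+1]) cylinder X s.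

Lemma bad_event_limsup d (T : measurableType d) (R : realType) (P : probability T R)
    (X : nat -> {RV P >-> R}) (D K m0 : nat) (eps : R) : prime_signs X ->
  (forall m j, (0 < j)%N ->
     #|bad_patterns D eps m j|%:R / 2 ^+ #|prime_le m| <= K%:R / j%:R ^+ 4 :> R) ->
  {ae P, forall w, exists n, forall j, (n <= j)%N -> ~ bad_event X D m0 eps j w}.
Proof.
move=> sX hK.
have mbad m j : measurable (\bigcup_(s in [set` bad_patterns D eps m j.+1]) cylinder X s).
  exact: (bigcup_cylinder_proba _ sX).1.
have mE j : measurable (bad_event X D m0 eps j) by apply: bigcup_measurable.
have PE j : (P (bad_event X D m0 eps j) <= ((m0.+2 * K)%:R / j.+1%:R ^+ 2)%:E)%E.
  rewrite /bad_event bigcup_mkord.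
  apply: le_trans (Boole_inequality P (fun i _ => mbad i j)) _.
  apply: (@le_trans _ _ (\sum_(m < (j.+1 ^ 2 + m0).+1) (K%:R / j.+1%:R ^+ 4)%:E)%E).
    apply: lee_sum => m _; apply: le_trans (bigcup_cylinder_proba _ sX).2 _.
    by rewrite lee_fin; exact: hK.
  rewrite sumEFin lee_fin sumr_const card_ord -[leLHS]mulr_natl.
  rewrite ler_pdivlMr ?exprn_gt0//.
  have -> : (j.+1 ^ 2 + m0).+1%:R * (K%:R / j.+1%:R ^+ 4) * j.+1%:R ^+ 2 =
    (j.+1 ^ 2 + m0).+1%:R * K%:R / j.+1%:R ^+ 2 :> R by field.
  rewrite ler_pdivrMr ?exprn_gt0// -natrX -!natrM ler_nat.
  by rewrite mulnAC leq_mul2r; apply/orP; right; nia.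
have lim0 : P (lim_sup_set (bad_event X D m0 eps)) = 0%E.
  apply: lim_sup_set_cvg0 => //.
  by apply: nneseries_inv_sq_lty PE _ => // j; exact: measure_ge0.
exists (lim_sup_set (bad_event X D m0 eps)); split => //.
  apply: bigcap_measurable => // n _; exact: bigcup_measurable.
move=> w /= nw n _; apply: contrapT => hn; apply: nw; exists n => j nj bw.
by apply: hn; exists j.
Qed.

Lemma Psi_bound_of_not_bad d (T : measurableType d) (R : realType) (P : probability T R)
    (X : nat -> {RV P >-> R}) (D m0 n : nat) (eps : R) (w : T) (x y : R) : 0 < eps ->
  (forall m N, admissible D m N -> m <= #|smooth_fam N m| ^ 2 + m0)%N ->
  (forall p, prime p -> X p w = 1 \/ X p w = -1) ->
  (forall j, (n <= j)%N -> ~ bad_event X D m0 eps j w) ->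
  0 <= x -> 1 <= y -> admissible D (Num.truncn y) (Num.truncn x) ->
  `|Psi (wintner X w) x y| <= n.+1%:R * Psi_star x y `^ (2^-1 + eps).
Proof.
move=> eps0 hm0 Xw notbad x0 y1 adm.
rewrite (Psi_famE (fun p => X p w))// Psi_starE//.
set m := Num.truncn y in adm *; set N := Num.truncn x in adm *.
have [m1 mN _] := adm.
pose s : {ffun prime_le m -> bool} := [ffun p => X (pval p) w == -1].
have sX p : X (pval p) w = (-1) ^+ s p.
  rewrite ffunE; have [->|->] := Xw _ (pval_prime p); last by rewrite eqxx.
  by case: eqP => // h; exfalso; lra.
set j := #|smooth_fam N m|.
have j0 : (0 < j)%N by apply: card_fam_gt0; lia.
under eq_bigr do under eq_bigr do rewrite sX.
have powj : 1 <= j%:R `^ (2^-1 + eps) :> R.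
  by rewrite -[leLHS](powRr0 j%:R) ler_powR ?ler1n// addr_ge0 ?invr_ge0// ltW.
have [jn|nj] := leqP j n.
  apply: (@le_trans _ _ j%:R).
    apply: le_trans (ler_norm_sum _ _ _) _.
    rewrite -sumr_const; apply: ler_sum => A _.
    by rewrite normr_prod big1// => p _; rewrite normrX normrN1 expr1n.
  apply: (@le_trans _ _ n.+1%:R); first by rewrite ler_nat leqW.
  by rewrite ler_peMr.
apply: (@le_trans _ _ (j%:R `^ (2^-1 + eps))); last first.
  by rewrite ler_peMl ?ler1n// (le_trans _ powj).
rewrite leNgt; apply/negP => big.
have jE : j.-1.+1 = j by rewrite prednK.
apply: (notbad j.-1); first by lia.
exists m => /=; first by rewrite jE ltnS; exact: hm0.
exists s => /=; last by move=> p; exact: sX.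
by rewrite jE inE; apply/asboolP; exists N.
Qed.

Theorem mainTheorem2 (R : realType) (eps : R) (eps_gt0 : 0 < eps) :
  exists C : R, 0 < C /\
    forall (d : measure_display) (T : measurableType d) (P : probability T R)
      (X : nat -> {RV P >-> R}),
    prime_signs X ->
    {ae P, forall w, exists K : R, 0 < K /\
      forall x y : R, 2 <= x -> 2 <= y -> C * ln x <= y ->
        `|Psi (wintner X w) x y| <= K * Psi_star x y `^ (2^-1 + eps)}.
Proof.
have [D [K [m0 [D0 hK hm0]]]] := bad_bounds eps_gt0.
exists ((6 * D)%:R / ln 2); split.
  by rewrite divr_gt0 ?ltr0n ?muln_gt0// ln_gt0// ltr1n.
move=> d T P X sX.
apply: filterS2 (prime_signs_ae sX) (bad_event_limsup m0 sX hK) => w Xw [n hn].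
exists n.+1%:R; split => // x y x2 y2 Cxy.
have bound y' : 2 <= y' -> admissible D (Num.truncn y') (Num.truncn x) ->
    `|Psi (wintner X w) x y'| <= n.+1%:R * Psi_star x y' `^ (2^-1 + eps).
  by move=> y'2; apply: Psi_bound_of_not_bad hm0 Xw hn _ _ => //; lra.
have x1 : (1 < Num.truncn x)%N by rewrite truncn_ge_nat//; lra.
have [yx|/ltW xy] := leP y x.
  apply: bound => //; split.
  - by rewrite truncn_ge_nat//; lra.
  - exact: le_truncn.
  - by left; exact: trunc_log_le_primes.
rewrite /Psi_star !(Psi_le _ xy); apply: bound => //; split => //.
by right; rewrite trunc_lognn.
Qed.
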